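(* Let $l\ge 1$, let $a_j,b_j,k_j$ $(1\le j\le l)$ be integers with $k_j\ge 1$ and $a_1\cdots a_l\ne 0$, and let $f(t)=\prod_{j=1}^{l}(a_jt^{k_j}-b_j)\in\mathbb{Z}[t]$. Then there is a constant $c=c(k_1,\ldots,k_l)>0$ such that there are polynomials $g\in\mathbb{Z}[t]$ of arbitrarily large degree $d$ for which $f(g(t))$ factors as a product of polynomials of degree at most $cd/(\log\log d)^{1/l}$. Consequently $f$ admits polysmoothness $\varepsilon$ for every $\varepsilon>0$.
   Context: A polynomial $f\in\mathbb{Z}[t]$ of positive degree admits polysmoothness $\theta$ (for a real $\theta\ge 0$) if there exists a non-constant polynomial $g\in\mathbb{Z}[t]$ such that every irreducible factor of $f(g(t))$ has degree at most $\theta\,(\deg f)(\deg g)$. *)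

(* Defs.v *)
(* for polynomials over int; Stdlib reals (R, ln, Rpower) for the
   real-valued bounds.  Real operations are written prefix (Rle, Rmult, ...) to
   avoid the %R delimiter clash between ring_scope and R_scope. *)
From mathcomp Require Import all_boot all_order all_algebra.
From Stdlib Require Import Reals.
Set Implicit Arguments. Unset Strict Implicit. Unset Printing Implicit Defensive.
Import GRing.Theory.
Local Open Scope ring_scope.

(* degree of a polynomial (deg 0 = 0 by convention; never used for 0 here) *)
Definition pdeg (p : {poly int}) : nat := (size p).-1.

Definition irreducible_int (q : {poly int}) : Prop :=
  q != 0 /\ q \isn't a GRing.unit /\
  forall r s : {poly int}, q = r * s -> r \is a GRing.unit \/ s \is a GRing.unit.

Definition factor_degrees_le (p : {poly int}) (B : R) : Prop :=
  forall q : {poly int}, irreducible_int q -> (exists s, p = q * s) ->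
    Rle (INR (pdeg q)) B.

Definition polysmooth (f : {poly int}) (theta : R) : Prop :=
  exists g : {poly int}, leq 2 (size g) /\
    factor_degrees_le (f \Po g) (Rmult theta (INR (pdeg f * pdeg g)%N)).

Definition smooth_bound (c : R) (l d : nat) : R :=
  Rdiv (Rmult c (INR d)) (Rpower (ln (ln (INR d))) (Rinv (INR l))).

Definition fpoly_prod (l : nat) (a b : 'I_l -> int) (k : 'I_l -> nat) : {poly int} :=
  \prod_(j < l) (a j *: 'X^(k j) - (b j)%:P).

(* Main.v *)
(** Take [g = z t^M] with [M] the product of pairwise coprime moduli [m_j]
prime to [k_j].  By the Chinese remainder theorem, [z] can be chosen as a product of
powers of the [a_i] and [b_i] with [a_j z^(k_j) = b_j e_j^(m_j)] for every
[j], so that [a_j g^(k_j) - b_j = b_j (h_j^(m_j) - 1)] with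
[h_j = e_j t^(k_j M / m_j)].  Composing the cyclotomic factorisation with
[h_j], this splits into factors of degree at most
[phi(m_j) k_j M / m_j].  It remains to make all [phi(m_j) / m_j] of order
[(log log M)^(-1/l)]: the primes in [(K, x]] are dealt out one by one to the
class whose density [phi(m_j) / m_j] is currently largest, which keeps the
densities within a factor 2 of each other, and their product is the product
of the [1 - 1/p], which is [O(1 / log x)] by Euler's comparison with the
harmonic sum.  Since [M <= x^x], [log log M <= 2 log x]. *)
Require Import Defs.
From Stdlib Require Import Reals.
From mathcomp Require Import all_boot all_order all_algebra all_field.
From mathcomp Require Import Rstruct zify ring lra.
Import Order.TTheory GRing.Theory Num.Theory.
Local Open Scope ring_scope.
Set Implicit Arguments. Unset Strict Implicit. Unset Printing Implicit Defensive.

(** * Totients, their densities, and products over primes *)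

(** Serves to bound all cyclotomic degrees [phi(d)], [d] dividing [m], by [phi(m)]. In the product
    formula the primes of [m] missing from [d] contribute factors at least 1, and for the others the
    exponent can only grow. *)
Lemma totient_le_dvd (d m : nat) : (0 < m)%N -> (d %| m)%N -> (totient d <= totient m)%N.
Proof.
move=> m0 dm; have d0 := dvdn_gt0 m0 dm; rewrite !totientE //.
have perm_d : perm_eq (primes d) [seq p <- primes m | p \in primes d].
  apply: uniq_perm; rewrite ?filter_uniq ?primes_uniq // => p.
  rewrite mem_filter andbC; case: (boolP (p \in primes d)); rewrite ?andbF // andbT.
  by rewrite !mem_primes m0 d0 /= => /andP[-> pd]; rewrite (dvdn_trans pd dm).
rewrite (perm_big _ perm_d) big_filter big_mkcond big_seq [leqRHS]big_seq.
apply: leq_prod => p; rewrite mem_primes => /and3P[p_pr _ _]; have p0 := prime_gt0 p_pr.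
case: ifP => _; last by rewrite muln_gt0 expn_gt0 p0 -subn1 subn_gt0 prime_gt1.
by rewrite leq_mul2l leq_pexp2l ?orbT // -!subn1 leq_sub2r // dvdn_leq_log.
Qed.

Section PrimeDensity.
Variable F : realFieldType.

Definition totient_density (m : nat) : F := (totient m)%:R / m%:R.

Lemma totient_density1 : totient_density 1 = 1.
Proof. exact: divr1. Qed.

Lemma totient_density_ge0 (m : nat) : 0 <= totient_density m.
Proof. by rewrite divr_ge0. Qed.

Lemma totient_density_primeM (p m : nat) :
  prime p -> coprime p m -> totient_density (p * m) = (1 - p%:R^-1) * totient_density m.
Proof.
move=> p_pr cop; have p0 : p%:R != 0 :> F by rewrite pnatr_eq0 -lt0n prime_gt0.
rewrite /totient_density totient_coprime // totient_prime // !natrM invfM mulrACA.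
by rewrite -subn1 natrB ?prime_gt0 // mulrBl divff // mul1r.
Qed.

Lemma one_sub_inv_prime (p : nat) : prime p -> 2^-1 <= 1 - (p%:R : F)^-1 <= 1.
Proof.
move=> p_pr; have p2 : 2 <= p%:R :> F by rewrite ler_nat prime_gt1.
have : p%:R^-1 <= 2^-1 :> F by rewrite lef_pV2 // posrE; lra.
have : 0 <= p%:R^-1 :> F by rewrite invr_ge0.
by move=> *; lra.
Qed.

(** Induction on [s], giving the new prime [p] to a class [j] of largest density. Since [1 - 1/p]
    lies in [[1/2, 1]], the new density of [j] is at least half the old maximum and at most its old
    value, so the ratio bound 2 survives. *)
Lemma balanced_coprime_split (l : nat) (s : seq nat) :
  (0 < l)%N -> uniq s -> all prime s ->
  exists m : 'I_l -> nat,
  [/\ (\prod_j m j = \prod_(p <- s) p)%N,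
      forall i j, i != j -> coprime (m i) (m j),
      \prod_j totient_density (m j) = \prod_(p <- s) (1 - p%:R^-1)
    & forall i j, totient_density (m i) <= 2 * totient_density (m j)].
Proof.
case: l => // l _.
elim: s => [|p s IH] /=.
  exists (fun=> 1%N); split=> [|i j _||i j].
  - by rewrite big_nil big1.
  - exact: coprimen1.
  - by rewrite big_nil big1 // => i _; exact: totient_density1.
  - by rewrite totient_density1; lra.
move=> /andP[p_s uniq_s] /andP[p_pr s_pr].
have [m [Em cop_m Edens le2]] := IH uniq_s s_pr.
have cop_p j : coprime p (m j).
  have : coprime p (\prod_(q <- s) q).
    rewrite big_seq; apply: (big_ind (fun t => coprime p t)) => [|x y px py|q qs].
    - exact: coprimen1.
    - by rewrite coprimeMr px.
    - rewrite prime_coprime // dvdn_prime2 //; last exact: (allP s_pr).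
      by apply: contraNneq p_s => ->.
  by apply: coprime_dvdr; rewrite -Em (bigD1 j) //= dvdn_mulr.
case: (@arg_maxP _ F _ (@ord0 l) xpredT (fun j => totient_density (m j)) isT) => j _ max_j.
have /andP[w_ge w_le] := one_sub_inv_prime p_pr.
have dens_j : totient_density (p * m j) = _ := totient_density_primeM p_pr (cop_p j).
have dj0 := totient_density_ge0 (m j).
exists (fun i => if i == j then p * m j else m i)%N; split=> [|i i' ii'||i i'].
- rewrite big_cons -Em (bigD1 j) //= eqxx (bigD1 (P := xpredT) j) //= mulnA; congr (_ * _)%N.
  by apply: eq_bigr => i /negbTE ->.
- case: (eqVneq i j) => [ij|ij]; case: (eqVneq i' j) => [i'j|i'j].
  + by rewrite ij i'j eqxx in ii'.
  + by rewrite coprimeMl cop_p cop_m // -ij.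
  + by rewrite coprimeMr (coprime_sym _ p) cop_p cop_m // -i'j.
  + exact: cop_m.
- rewrite big_cons -Edens (bigD1 j) //= eqxx (bigD1 (P := xpredT) j) //= mulrA dens_j.
  by congr (_ * _); apply: eq_bigr => i /negbTE ->.
- have := le2 j i'; have := max_j i isT; rewrite /= => hi hi'.
  have : 2^-1 * totient_density (m j) <= (1 - p%:R^-1) * totient_density (m j) by rewrite ler_wpM2r.
  have : (1 - p%:R^-1) * totient_density (m j) <= 1 * totient_density (m j) by rewrite ler_wpM2r.
  case: (eqVneq i j) => [ij|ij]; case: (eqVneq i' j) => [i'j|i'j]; rewrite ?dens_j; lra.
Qed.

(* Terms divisible by [p] contribute at most [1/p] times the whole sum.
   The index [i = 0] is harmless, as [0^-1 = 0]. *)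
Lemma sum_smooth_inv_le (s : seq nat) (n : nat) :
  all prime s ->
  (\sum_(i < n.+1 | all [in s] (primes i)) (i : nat)%:R^-1) *
    \prod_(p <- s) (1 - p%:R^-1) <= (1 : F).
Proof.
elim: s => [_|p s IH /= /andP[p_pr s_pr]].
  rewrite big_nil mulr1 big_mkcond big_ord_recl /= invr0 add0r.
  case: n => [|n]; first by rewrite big_ord0.
  rewrite big_ord_recl big1 ?addr0 //= ?invr1 // => i _.
  case: ifP => // /allP primes_nil.
  have : primes (bump 0 (bump 0 i)) == [::].
    by case: (primes _) primes_nil => // q s /(_ q (mem_head _ _)).
  by rewrite primes_eq0.
rewrite big_cons mulrA; apply: le_trans (IH s_pr).
apply: ler_wpM2r.
  rewrite big_seq; apply: prodr_ge0 => q /(allP s_pr) /one_sub_inv_prime; lra.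
set T := (X in X * _); rewrite mulrBr mulr1 lerBlDr {1}/T.
rewrite (bigID (fun i : 'I_n.+1 => (p %| i)%N)) /= addrC; apply: lerD.
  rewrite big_mkcond [leRHS]big_mkcond; apply: ler_sum => i _.
  case: ifP => [/andP[/allP i_ps p_i]|_].
    rewrite ifT //; apply/allP => q qi; move: (i_ps q qi); rewrite inE => /orP[/eqP qp|//].
    by move: qi p_i; rewrite qp mem_primes => /and3P[_ _ ->].
  by case: ifP => // _; rewrite invr_ge0.
(* The multiples of [p] are written as [p * i] with [i] again smooth, so that their sum is compared
   termwise with [T / p]. *)
rewrite (reindex_onto (fun i : 'I_n.+1 => inord (p * i)%N) (fun i : 'I_n.+1 => inord (i %/ p)%N))
  /=; last first.
  move=> i /andP[_ p_i].
  have ip_n : (i %/ p < n.+1)%N by rewrite ltnS (leq_trans (leq_div _ _)) // -ltnS.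
  by rewrite (inordK ip_n) mulnC divnK // inord_val.
rewrite /T mulr_suml big_mkcond [leRHS]big_mkcond; apply: ler_sum => i _.
(* [inord] sends an out-of-range [p * i] to 0, whose inverse is 0, so such terms vanish. *)
rewrite [_%:R in leLHS](_ : _ = if (p * i < n.+1)%N then (p * i)%N%:R else 0); last first.
  by rewrite /inord val_insubd; case: ifP.
case: (ltnP (p * i) n.+1) => [pi_n|n_pi]; last first.
  by rewrite invr0 if_same; case: ifP => // _; rewrite mulr_ge0 ?invr_ge0.
rewrite inordK //; case: ifP => [/andP[/andP[/allP pi_ps _] _]|_].
  rewrite ifT; first by rewrite natrM invfM mulrC.
  apply/allP => q; rewrite mem_primes => /and3P[q_pr i0 q_i]; apply: pi_ps.
  by rewrite mem_primes q_pr muln_gt0 prime_gt0 // i0 dvdn_mull.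
by case: ifP => // _; rewrite mulr_ge0 ?invr_ge0.
Qed.

(** The constant is [1 / W], where [W] is the product over the primes up to [K]. Multiplying by [W]
    completes the product to all primes up to [x]; every [i <= x] has its prime factors among these,
    so [sum_smooth_inv_le] applies to the full harmonic sum. *)
Lemma prod_primes_harmonic_le (K : nat) :
  exists C : F, 0 < C /\ forall x : nat, (K <= x)%N ->
    (\prod_(K.+1 <= p < x.+1 | prime p) (1 - p%:R^-1)) *
      (\sum_(1 <= i < x.+1) i%:R^-1) <= C.
Proof.
pose W : F := \prod_(0 <= p < K.+1 | prime p) (1 - p%:R^-1).
have W0 : 0 < W.
  by apply: prodr_gt0 => p /one_sub_inv_prime; lra.
exists W^-1; split=> [|x Kx]; first by rewrite invr_gt0.
rewrite -[leRHS]mul1r ler_pdivlMr // mulrC mulrA -big_cat_nat //= mulrC.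
pose s := [seq p <- index_iota 0 x.+1 | prime p].
have s_pr : all prime s by exact: filter_all.
have := sum_smooth_inv_le x s_pr; rewrite big_filter.
apply: le_trans; apply: ler_wpM2r.
  by apply: prodr_ge0 => p /one_sub_inv_prime; lra.
rewrite [leLHS](_ : _ = \sum_(i < x.+1) (i : nat)%:R^-1); last first.
  by rewrite -(big_mkord xpredT (fun i => i%:R^-1)) [RHS]big_ltn // invr0 add0r.
rewrite le_eqVlt; apply/orP; left; apply/eqP; apply: eq_bigl => i.
apply/esym/allP => q; rewrite mem_primes => /and3P[q_pr i0 q_i].
by rewrite /= mem_filter q_pr mem_index_iota /= (leq_ltn_trans (dvdn_leq i0 q_i)).
Qed.

End PrimeDensity.

Arguments totient_density {F} m.
Arguments balanced_coprime_split {F l s}.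
Arguments prod_primes_harmonic_le {F} K.

(** * Irreducible factors over the integers and their degrees *)

Lemma pdegM (p q : {poly int}) :
  p != 0 -> q != 0 -> pdeg (p * q) = (pdeg p + pdeg q)%N.
Proof.
move=> p0 q0; rewrite /pdeg size_mul //.
by move: p0 q0; rewrite -!size_poly_gt0; case: (size p) (size q) => [|m] [|n] //= _ _; rewrite addnS.
Qed.

(** The relation [%|] ignores integer scalars. A non-constant irreducible [q] has unit content, so
    Gauss's lemma turns it into true divisibility. *)
Lemma irreducible_int_dvdP (q p : {poly int}) :
  irreducible_int q -> (1 < size q)%N -> (q %| p <-> exists s, p = q * s).
Proof.
move=> [_ [_ irr]] size_q; split=> [/dvdpP_int [s ->]|[s ->]]; last exact: dvdp_mulr.
have Eq: q = (zcontents q)%:P * zprimitive q by rewrite mul_polyC -zpolyEprim.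
case: (irr _ _ Eq) => [uc|/andP[]]; last first.
  by rewrite size_zprimitive => /eqP size1; rewrite size1 in size_q.
move: Eq uc; set c := _%:P; set r := zprimitive q => Eq uc.
by exists (c^-1 * s); rewrite mulrA Eq [c * r]mulrC mulrK.
Qed.

(** If [q] is not coprime to [p1], the primitive part of their gcd is a non-unit factor of [q].
    Irreducibility makes the cofactor a unit, so [q] divides the gcd up to a scalar, hence [p1]. *)
Lemma irreducible_int_dvdM (q p1 p2 : {poly int}) :
  irreducible_int q -> (1 < size q)%N -> q %| p1 * p2 -> (q %| p1) || (q %| p2).
Proof.
move=> [_ [_ irr]] size_q q_dv.
case: (boolP (coprimep q p1)) => [cop|]; first by rewrite -(Gauss_dvdpr p2 cop) q_dv orbT.
rewrite /coprimep => ncop.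
have [r Eq] := dvdpP_int (dvdp_gcdl q p1).
case: (irr _ _ Eq) => [/andP[]|]; first by rewrite size_zprimitive (negbTE ncop).
case/andP=> /size_poly1P[c c0 Er] _.
have q_dv_gcd: q %| gcdp q p1.
  rewrite [X in X %| _]Eq Er mulrC mul_polyC dvdpZl //.
  rewrite [X in _ %| X]zpolyEprim dvdpZr // zcontents_eq0 gcdp_eq0 negb_and.
  by rewrite -size_poly_gt0 (ltnW size_q).
by rewrite (dvdp_trans q_dv_gcd (dvdp_gcdr _ _)).
Qed.

Section FactorDegrees.
Variable B : R.
Hypothesis B_ge0 : Rle R0 B.

Lemma factor_degrees_leM (p1 p2 : {poly int}) :
  factor_degrees_le p1 B -> factor_degrees_le p2 B -> factor_degrees_le (p1 * p2) B.
Proof.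
move=> le1 le2 q irr_q q_dv.
(* Irreducible constants, such as prime integers, have degree 0; only non-constant factors need the
   primality argument. *)
case: (leqP (size q) 1) => size_q.
  by have -> : pdeg q = 0%N by rewrite /pdeg; lia.
move/(irreducible_int_dvdP _ irr_q size_q): q_dv => /(irreducible_int_dvdM irr_q size_q).
by case/orP=> /(irreducible_int_dvdP _ irr_q size_q); [apply: le1 | apply: le2].
Qed.

Lemma factor_degrees_le_pdeg (p : {poly int}) :
  p != 0 -> Rle (INR (pdeg p)) B -> factor_degrees_le p B.
Proof.
move=> p0 le_pB q irr_q [s Ep]; apply: Rle_trans le_pB; apply: le_INR.
have [q0 s0] : q != 0 /\ s != 0 by move: p0; rewrite Ep mulf_eq0 negb_or => /andP.
by rewrite Ep pdegM //; lia.
Qed.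

Lemma factor_degrees_le_const (c : int) : c != 0 -> factor_degrees_le c%:P B.
Proof.
by move=> c0; apply: factor_degrees_le_pdeg; rewrite ?polyC_eq0 // /pdeg size_polyC c0.
Qed.

Lemma factor_degrees_le_prod (I : eqType) (s : seq I) (F : I -> {poly int}) :
  (forall i, i \in s -> factor_degrees_le (F i) B) ->
  factor_degrees_le (\prod_(i <- s) F i) B.
Proof.
move=> leF; rewrite big_seq.
apply: (big_ind (fun p => factor_degrees_le p B)) => //.
- by rewrite -polyC1; exact: factor_degrees_le_const.
- exact: factor_degrees_leM.
Qed.

End FactorDegrees.

(** [h^m - 1] is the product of the ['Phi_d \Po h] over [d] dividing [m], of degrees
    [phi(d) deg h <= phi(m) deg h]. *)
Lemma factor_degrees_le_sub1 (h : {poly int}) (m : nat) (B : R) :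
  (0 < m)%N -> (0 < pdeg h)%N ->
  Rle (INR (totient m * pdeg h)) B -> factor_degrees_le (h ^+ m - 1) B.
Proof.
move=> m0 h0 leB.
have B0 : Rle R0 B by apply: Rle_trans leB; exact: pos_INR.
have -> : h ^+ m - 1 = \prod_(d <- divisors m) ('Phi_d \Po h).
  by rewrite -rmorph_prod /= prod_Cyclotomic // rmorphB /= comp_Xn_poly rmorph1.
apply: factor_degrees_le_prod => // d; rewrite -dvdn_divisors // => dm.
have deg_Phi : pdeg ('Phi_d \Po h) = (totient d * pdeg h)%N.
  by rewrite /pdeg size_comp_poly size_Cyclotomic.
apply: factor_degrees_le_pdeg => //.
  have : (0 < totient d * pdeg h)%N by rewrite muln_gt0 totient_gt0 (dvdn_gt0 m0 dm).
  by apply: contraTneq => Phi0; rewrite -deg_Phi Phi0 /pdeg size_poly0.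
rewrite deg_Phi; apply: Rle_trans leB; apply: le_INR; apply/ssrnat.leP.
by rewrite leq_mul2r totient_le_dvd ?orbT.
Qed.

(** * Choice of the coefficient [z] *)

(** Bezout gives natural exponents with [1 + u n = x m] and [1 + y m = v n]. With [z = a^u b^v] and
    [e = a^x b^y], both sides equal [a^(x m) b^(v n)]. *)
Lemma coprime_power_ratio (a b : int) (m n : nat) :
  a != 0 -> b != 0 -> (0 < m)%N -> (0 < n)%N -> coprime m n ->
  exists z e : int, z != 0 /\ a * z ^+ n = b * e ^+ m.
Proof.
move=> a0 b0 m0 n0 /eqP cop.
have [u _ /dvdnP[x Ex]] := Bezoutl n m0; have [y _ /dvdnP[v Ev]] := Bezoutl m n0.
rewrite gcdnC in Ev; rewrite cop in Ex Ev.
exists (a ^+ u * b ^+ v), (a ^+ x * b ^+ y).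
split; first by rewrite mulf_neq0 ?expf_neq0.
by rewrite !exprMn -!exprM -Ev -Ex !exprD !expr1 [LHS]mulrA mulrCA.
Qed.

(** Each condition is solved separately by some [z_i] with exponent [N_i k_i], where [N_i] is the
    product of the other moduli; then [z] is the product of the [z_i^(N_i)]. In the condition for
    [j], every factor with [i != j] is an [m_j]-th power, because [m_j] divides [N_i]. *)
Lemma simultaneous_power_ratio (l : nat) (a b : 'I_l -> int) (k m : 'I_l -> nat) :
  (forall j, a j != 0) -> (forall j, b j != 0) ->
  (forall j, 0 < m j)%N -> (forall j, 0 < k j)%N ->
  (forall i j, i != j -> coprime (m i) (m j)) -> (forall j, coprime (m j) (k j)) ->
  exists z : int, z != 0 /\
    forall j, exists e : int, a j * z ^+ k j = b j * e ^+ m j.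
Proof.
move=> a0 b0 m0 k0 cop_m cop_k.
pose N i := (\prod_(j < l | j != i) m j)%N.
have N0 i : (0 < N i)%N by apply: prodn_gt0.
have cop_N i : coprime (m i) (N i * k i)%N.
  rewrite coprimeMr cop_k andbT /N.
  apply: (big_ind (fun t => coprime (m i) t)) => [|x y ix iy|j ji].
  - exact: coprimen1.
  - by rewrite coprimeMr ix.
  - by apply: cop_m; rewrite eq_sym.
have ex_z i : exists z, z != 0 /\ exists e, a i * z ^+ (N i * k i) = b i * e ^+ m i.
  have Nk0 : (0 < N i * k i)%N by rewrite muln_gt0 N0 k0.
  have [z [e [z_neq0 Ez]]] := coprime_power_ratio (a0 i) (b0 i) (m0 i) Nk0 (cop_N i).
  by exists z; split=> //; exists e.
have [z Hz] := fin_all_exists ex_z.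
exists (\prod_i z i ^+ N i); split.
  by apply/prodf_neq0 => i _; rewrite expf_neq0 //; case: (Hz i).
move=> j; have [_ [e Ee]] := Hz j.
exists (e * \prod_(i | i != j) z i ^+ (N i %/ m j * k j)).
rewrite (bigD1 j) //= exprMn mulrA -exprM Ee exprMn mulrA; congr (_ * _).
rewrite -!prodrXl; apply: eq_bigr => i ij; rewrite -!exprM; congr (_ ^+ _).
have mj_dv: (m j %| N i)%N by rewrite /N (bigD1 j) 1?eq_sym //= dvdn_mulr.
by rewrite -{1}(divnK mj_dv); lia.
Qed.

(** * Logarithm estimates *)

Lemma ln1 : ln 1 = 0.
Proof. exact: ln_1. Qed.

Lemma ler_ln (x y : R) : 0 < x -> x <= y -> ln x <= ln y.
Proof.
move=> x0; rewrite le_eqVlt => /orP[/eqP -> //|xy].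
by apply/ltW/RltP/ln_increasing; apply/RltP.
Qed.

Lemma ln_gt0 (x : R) : 1 < x -> 0 < ln x.
Proof.
by move=> /RltP x1; have /RltP := ln_increasing _ _ Rlt_0_1 x1; rewrite ln_1.
Qed.

Lemma ln_le_sub1 (y : R) : 0 < y -> ln y <= y - 1.
Proof.
move=> y0; rewrite -[leRHS]ln_exp; apply: ler_ln => //.
by apply: le_trans (introT RleP (exp_ineq1_le _)); rewrite RplusE R1E; lra.
Qed.

Lemma ln_mulr (x y : R) : 0 < x -> 0 < y -> ln (x * y) = ln x + ln y.
Proof. by move=> /RltP x0 /RltP y0; exact: ln_mult. Qed.

Lemma ln_exprn (x : R) (n : nat) : 0 < x -> ln (x ^+ n) = n%:R * ln x.
Proof.
move=> x0; elim: n => [|n IH]; first by rewrite mul0r expr0 ln1.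
by rewrite exprS ln_mulr ?exprn_gt0 // IH -natr1 mulrDl mul1r addrC.
Qed.

Lemma ln_succ_le_harmonic (n : nat) : ln n.+1%:R <= \sum_(1 <= i < n.+1) i%:R^-1.
Proof.
elim: n => [|n IH]; first by rewrite big_geq // ln1.
rewrite big_nat_recr //=.
have n0 : 0 < n.+1%:R :> R by rewrite ltr0n.
have y0 : 0 < 1 + n.+1%:R^-1 :> R by rewrite addr_gt0 ?invr_gt0.
have -> : n.+2%:R = n.+1%:R * (1 + n.+1%:R^-1) :> R.
  by rewrite mulrDr mulr1 divff ?gt_eqF // -natr1.
rewrite ln_mulr // lerD // (le_trans (ln_le_sub1 y0)) //.
by rewrite addrAC subrr add0r.
Qed.

(** [ln m <= x ln x <= x^2], so [ln (ln m) <= 2 ln x], and [ln x] is at most the harmonic sum. *)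
Lemma ln_ln_le (x m : nat) : (1 < m)%N -> (m <= x ^ x)%N ->
  ln (ln m%:R) <= 2 * \sum_(1 <= i < x.+1) i%:R^-1.
Proof.
move=> m1 m_le.
have x0 : 0 < x%:R :> R.
  by rewrite ltr0n; case: x m_le => // m_le; move: (leq_trans m1 m_le).
have ln_m0 : 0 < ln m%:R.
  by rewrite ln_gt0 // ltr1n.
have ln_m : ln m%:R <= x%:R ^+ 2.
  apply: (@le_trans _ _ (ln (x%:R ^+ x))); last first.
    rewrite ln_exprn // expr2 ler_wpM2l ?(ltW x0) //.
    by apply: le_trans (ln_le_sub1 x0) _; rewrite gerBl.
  by apply: ler_ln; [rewrite ltr0n ltnW | rewrite -natrX ler_nat].
apply: (le_trans (ler_ln ln_m0 ln_m)); rewrite ln_exprn // ler_wpM2l //.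
apply: le_trans (ln_succ_le_harmonic x).
by rewrite ler_ln // ler_nat.
Qed.

Lemma Rpower_inv_exprn (x : R) (n : nat) :
  (0 < n)%N -> 0 < x -> Rpower x (Rinv (INR n)) ^+ n = x.
Proof.
move=> n0 /RltP x0; rewrite -RpowE -Rpower_pow; last exact: exp_pos.
rewrite Rpower_mult Rinv_l ?Rpower_1 //.
by apply: not_0_INR => n0'; rewrite n0' in n0.
Qed.

(** * Construction of the moduli *)

Lemma totient_balanced_moduli (l : nat) (k : 'I_l -> nat) :
  (0 < l)%N -> (forall j, 0 < k j)%N ->
  exists C : R, 0 < C /\ forall D : nat, exists m : 'I_l -> nat,
  [/\ forall j, (0 < m j)%N,
      forall i j, i != j -> coprime (m i) (m j),
      forall j, coprime (m j) (k j),
      (D <= \prod_j m j)%N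
    & forall j, (totient_density (m j) : R) *
        Rpower (ln (ln (INR (\prod_j m j)%N))) (Rinv (INR l)) <= C].
Proof.
move=> l0 k0; pose K := (\sum_j k j)%N.
have [C [C0 leC]] : exists C : R, _ := prod_primes_harmonic_le K.
(* [A] bounds the [l]-th power of density times root: [2^l] comes from balancing, 2 from [ln_ln_le],
   [C] from Euler's comparison. As [A <= (1 + A)^l], the constant [1 + A] avoids an [l]-th root. *)
pose A := 2 ^+ l * (2 * C); have A0 : 0 < A by rewrite !mulr_gt0 ?exprn_gt0.
have A1 : 0 < 1 + A by rewrite addr_gt0.
exists (1 + A); split=> // D.
(* Exceeding [D] makes the product large, exceeding 4 makes its iterated logarithm positive, and
   exceeding [K] puts [p] itself into [s]. *)
have [p] := prime_above (maxn (maxn D 4) K).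
rewrite !gtn_max => /andP[/andP[D_p p_gt4] K_p] p_pr.
pose s := [seq q <- index_iota K.+1 p.+1 | prime q].
have s_pr : all prime s by exact: filter_all.
have uniq_s : uniq s by rewrite filter_uniq ?iota_uniq.
have [m [Em cop_m Edens balanced]] := balanced_coprime_split (F := R) l0 uniq_s s_pr.
have p_s : p \in s by rewrite mem_filter p_pr mem_index_iota K_p ltnSn.
have prod_s0 : (0 < \prod_(q <- s) q)%N.
  by rewrite big_seq prodn_cond_gt0 // => q /(allP s_pr) /prime_gt0.
have m_dv j : (m j %| \prod_(q <- s) q)%N by rewrite -Em (bigD1 j) //= dvdn_mulr.
have p_le : (p <= \prod_(q <- s) q)%N.
  by apply: dvdn_leq => //; rewrite (big_rem p) //= dvdn_mulr.
(* [s] has at most [p] elements, each at most [p]. *)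
have prod_le : (\prod_(q <- s) q <= p ^ p)%N.
  apply: (@leq_trans (p ^ size s)); last first.
    rewrite leq_pexp2l ?prime_gt0 // size_filter (leq_trans (count_size _ _)) //.
    by rewrite size_iota subSS leq_subr.
  rewrite -iter_muln_1 -[size s](count_predT s) -big_const_seq big_seq [leqRHS]big_seq.
  by apply: leq_prod => q; rewrite mem_filter mem_index_iota => /and3P[_ _].
exists m; split=> //.
- by move=> j; exact: dvdn_gt0 (m_dv j).
- move=> j; apply: (coprime_dvdl (m_dv j)); rewrite big_seq.
  apply: (big_ind (fun t => coprime t (k j))) => [|a b a_k b_k|q].
  + exact: coprime1n.
  + by rewrite coprimeMl a_k.
  + rewrite mem_filter mem_index_iota => /and3P[q_pr K_q _].
    rewrite prime_coprime // gtnNdvd //; apply: leq_trans K_q.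
    by rewrite ltnS /K (bigD1 j) //= leq_addr.
- by rewrite Em (leq_trans (ltnW D_p)).
- move=> j; rewrite Em INRE; set L := ln (ln _).
  set rho := Rpower _ _; set d := totient_density (m j).
  have d0 : 0 <= d := totient_density_ge0 _ _.
  have L0 : 0 < L.
    apply: ln_gt0; rewrite -[X in X < _]ln_exp; apply/RltP/ln_increasing; first exact: exp_pos.
    apply/RltP; apply: (@le_lt_trans _ _ 3); first by apply/RleP; exact: exp_le_3.
    by rewrite ltr_nat (leq_trans (ltnW p_gt4)).
  have rho0 : 0 < rho by apply/RltP; exact: exp_pos.
  have rhoE : rho ^+ l = L by exact: Rpower_inv_exprn.
  have leL : L <= 2 * \sum_(1 <= i < p.+1) i%:R^-1 by apply: ln_ln_le => //; apply: leq_trans p_le; apply: prime_gt1.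
  (* By balance [d] is at most twice each of the [l] densities; these inequalities are multiplied
     together. *)
  have d_le : d ^+ l <= 2 ^+ l * \prod_(q <- s) (1 - q%:R^-1).
    rewrite -Edens -[in 2 ^+ l](card_ord l) -[in d ^+ l](card_ord l) -!prodr_const -big_split /=.
    by apply: ler_prod => i _; rewrite d0 balanced.
  rewrite -(@ler_pXn2r _ l) ?nnegrE ?(ltW A1) ?(mulr_ge0 d0 (ltW rho0)) //.
  apply: (@le_trans _ _ A).
    rewrite exprMn rhoE.
    have -> : A = 2 ^+ l * C * 2 by rewrite /A mulrCA mulrC.
    apply: le_trans (ler_pM _ _ d_le leL) _; rewrite ?exprn_ge0 ?(ltW L0) //.
    rewrite mulrCA mulrC ler_wpM2r // -mulrA ler_wpM2l ?exprn_ge0 //.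
    by rewrite big_filter leC // ltnW.
  apply: (@le_trans _ _ (1 + A)); first by rewrite lerDr.
  by rewrite ler_eXnr // lerDl ltW.
Qed.

(** * The polynomial [f], its composition with a monomial, and the theorem *)

Lemma size_scaleXn_subC (a b : int) (k : nat) :
  a != 0 -> (0 < k)%N -> size (a *: 'X^k - b%:P) = k.+1.
Proof.
move=> a0 k0; rewrite size_polyDl size_scale ?size_polyXn //.
by rewrite size_polyN size_polyC; lia.
Qed.

Lemma fpoly_prod_neq0 (l : nat) (a b : 'I_l -> int) (k : 'I_l -> nat) :
  (forall j, 0 < k j)%N -> (forall j, a j != 0) -> fpoly_prod a b k != 0.
Proof.
move=> k0 a0; apply/prodf_neq0 => j _.
by rewrite -size_poly_gt0 size_scaleXn_subC.
Qed.

Lemma pdeg_fpoly_prod_gt0 (l : nat) (a b : 'I_l -> int) (k : 'I_l -> nat) :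
  (0 < l)%N -> (forall j, 0 < k j)%N -> (forall j, a j != 0) -> (0 < pdeg (fpoly_prod a b k))%N.
Proof.
case: l a b k => // l a b k _ k0 a0; have := fpoly_prod_neq0 b k0 a0.
rewrite /fpoly_prod (bigD1 ord0) //= mulf_eq0 negb_or => /andP[A0 B0].
by rewrite pdegM // [X in (X + _)%N]/pdeg size_scaleXn_subC // addn_gt0 k0.
Qed.

Lemma factor_degrees_leW (p : {poly int}) (B B' : R) :
  Rle B B' -> factor_degrees_le p B -> factor_degrees_le p B'.
Proof. by move=> leB le_p q irr_q q_dv; apply: Rle_trans leB; exact: le_p. Qed.

Lemma fpoly_prod_comp_scaleXn (l : nat) (a b : 'I_l -> int) (k : 'I_l -> nat) (z : int) (M : nat) :
  fpoly_prod a b k \Po (z *: 'X^M) =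
  \prod_(j < l) ((a j * z ^+ k j) *: 'X^(M * k j) - (b j)%:P).
Proof.
rewrite rmorph_prod; apply: eq_bigr => j _.
rewrite rmorphB /= comp_polyC linearZ /= comp_Xn_poly exprZn scalerA.
by rewrite -exprM.
Qed.

(** Handles the factors with [b_j = 0], which stay monomials after composition and split into a
    constant and copies of ['X]. *)
Lemma factor_degrees_le_scaleXn (c : int) (n : nat) (B : R) :
  c != 0 -> Rle R1 B -> factor_degrees_le (c *: 'X^n) B.
Proof.
move=> c0 B1; have B0 : Rle R0 B by apply: Rle_trans B1; exact: Rle_0_1.
rewrite -mul_polyC; apply: factor_degrees_leM => //.
  exact: factor_degrees_le_const.
elim: n => [|n IH]; first by rewrite expr0 -polyC1; exact: factor_degrees_le_const.
rewrite exprS; apply: factor_degrees_leM => //.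
by apply: factor_degrees_le_pdeg; rewrite ?polyX_eq0 // /pdeg size_polyX.
Qed.

Theorem theorem2p1 (l : nat) (k : 'I_l -> nat) :
  leq 1 l -> (forall j, leq 1 (k j)) ->
  exists c : R, Rlt R0 c /\
    forall a b : 'I_l -> int, \prod_(j < l) a j != 0 ->
      (forall D : nat, exists g : {poly int},
          leq D (pdeg g) /\
          factor_degrees_le (fpoly_prod a b k \Po g) (smooth_bound c l (pdeg g))) /\
      (forall eps : R, Rlt R0 eps -> polysmooth (fpoly_prod a b k) eps).
Proof.
move=> l0 k0; have [C [C0 ex_m]] := totient_balanced_moduli l0 k0.
pose K := (\sum_j k j)%N.
have K0 : (0 < K)%N.
  by rewrite /K (bigD1 (Ordinal l0)) //= addn_gt0 k0.
(* [K] bounds every [k_j], so the constant depends on the exponents alone. *)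
exists (C * K%:R); split; first by apply/RltP; rewrite mulr_gt0 ?ltr0n.
move=> a b /prodf_neq0 a_neq0; have a0 j : a j != 0 by exact: a_neq0.
have ex_g D : exists g : {poly int}, (D <= pdeg g)%N /\
    factor_degrees_le (fpoly_prod a b k \Po g) (smooth_bound (C * K%:R) l (pdeg g)).
  have [m [m0 cop_m cop_k D_le dens_le]] := ex_m D.
  (* When [b j = 0] the factor is a monomial, and [z] must still be nonzero. *)
  pose b' j := if b j == 0 then 1 else b j.
  have b'0 j : b' j != 0 by rewrite /b'; case: ifP => // /negbT.
  have [z [z0 ex_e]] := simultaneous_power_ratio a0 b'0 m0 k0 cop_m cop_k.
  set M := (\prod_j m j)%N in D_le dens_le *.
  have deg_g : pdeg (z *: 'X^M) = M by rewrite /pdeg size_scale // size_polyXn.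
  exists (z *: 'X^M); rewrite deg_g; split=> //.
  set B := smooth_bound _ _ _.
  have M0 : (0 < M)%N by rewrite prodn_gt0.
  have m_dv j : (m j %| M)%N by rewrite /M (bigD1 j) //= dvdn_mulr.
  (* The degree is the density of [m_j] times [M k_j]; the density is at most [C / rho] and [k_j] at
     most [K]. *)
  have le_B j : (totient (m j) * (M %/ m j * k j))%N%:R <= B.
    rewrite /B /smooth_bound RdivE RmultE INRE.
    set rho := Rpower _ _; have rho0 : 0 < rho by apply/RltP; exact: exp_pos.
    have m_neq0 : (m j)%:R != 0 :> R by rewrite pnatr_eq0 -lt0n.
    rewrite ler_pdivlMr // natrM.
    have -> : (totient (m j))%:R = totient_density (m j) * (m j)%:R :> R.
      by rewrite /totient_density divfK.
    have -> : totient_density (m j) * (m j)%:R * (M %/ m j * k j)%:R * rho =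
        totient_density (m j) * rho * (M * k j)%:R.
      rewrite -[in RHS](divnK (m_dv j)) !natrM; ring.
    rewrite natrM mulrA [leRHS]mulrAC; apply: ler_pM => //.
    - by rewrite mulr_ge0 // (mulr_ge0 (totient_density_ge0 _ _) (ltW rho0)).
    - by rewrite ler_wpM2r //; move: (dens_le j); rewrite INRE.
    - by rewrite ler_nat /K (bigD1 j) //= leq_addr.
  have B0 : Rle R0 B.
    by apply/RleP; apply: le_trans (le_B (Ordinal l0)); exact: ler0n.
  rewrite fpoly_prod_comp_scaleXn; apply: factor_degrees_le_prod => // j _.
  have Mm0 : (0 < M %/ m j * k j)%N by rewrite muln_gt0 k0 divn_gt0 // dvdn_leq.
  have az0 : a j * z ^+ k j != 0 by rewrite mulf_neq0 ?expf_neq0.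
  case: (eqVneq (b j) 0) => [bj0|bj0].
    rewrite bj0 polyC0 subr0; apply: factor_degrees_le_scaleXn => //.
    (* [B >= 1] because [le_B] places a positive integer below it. *)
    by apply/RleP; apply: le_trans (le_B j); rewrite (ler_nat _ 1) muln_gt0 totient_gt0 m0.
  have [e Ee] := ex_e j; move: Ee az0; rewrite /b' (negbTE bj0) => -> be0.
  have e0 : e != 0.
    by apply: contraNneq be0 => ->; rewrite expr0n gtn_eqF // mulr0.
  have -> : (b j * e ^+ m j) *: 'X^(M * k j) - (b j)%:P =
      (b j)%:P * ((e *: 'X^(M %/ m j * k j)) ^+ m j - 1).
    rewrite mulrBr mulr1 mul_polyC exprZn scalerA -exprM; congr (_ *: 'X^_ - _).
    by rewrite -{1}(divnK (m_dv j)); lia.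
  apply: factor_degrees_leM => //; first exact: factor_degrees_le_const.
  have deg_h : pdeg (e *: 'X^(M %/ m j * k j)) = (M %/ m j * k j)%N.
    by rewrite /pdeg size_scale // size_polyXn.
  by apply: factor_degrees_le_sub1; rewrite ?deg_h // INRE; apply/RleP.
split=> // eps /RltP eps0.
(* Once [d >= exp (exp (t^l))], the root of [ln (ln d)] is at least [t], so the smooth bound is at
   most [C K d / t = eps d]. *)
pose t := C * K%:R / eps.
have t0 : 0 < t by rewrite divr_gt0 // mulr_gt0 ?ltr0n.
pose x := exp (exp (t ^+ l)).
have x0 : 0 <= x by apply/ltW/RltP; exact: exp_pos.
(* The 2 in the maximum ensures that [g] is not constant. *)
have [g [D_le le_g]] := ex_g (maxn 2 (Num.bound x)).
have x_le : x <= (pdeg g)%:R.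
  by apply: le_trans (ltW (archi_boundP x0)) _; rewrite ler_nat (leq_trans _ D_le) ?leq_maxr.
exists g; split; first by move: D_le; rewrite /pdeg; lia.
apply: factor_degrees_leW le_g; apply/RleP.
rewrite /smooth_bound RdivE !RmultE !INRE; set L := ln (ln _); set rho := Rpower _ _.
have rho0 : 0 < rho by apply/RltP; exact: exp_pos.
have L_ge : t ^+ l <= L.
  rewrite -[t ^+ l]ln_exp -[exp (t ^+ l)]ln_exp; apply: ler_ln.
    by rewrite ln_exp; apply/RltP; exact: exp_pos.
  by apply: ler_ln => //; apply/RltP; exact: exp_pos.
have L0 : 0 < L by apply: lt_le_trans L_ge; rewrite exprn_gt0.
have t_le : t <= rho.
  by rewrite -(@ler_pXn2r _ l) ?nnegrE ?(ltW t0) ?(ltW rho0) // /rho -(INRE l) Rpower_inv_exprn.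
have -> : C * K%:R = t * eps by rewrite divfK ?gt_eqF.
rewrite ler_pdivrMr // natrM.
have deg_f : 1 <= (pdeg (fpoly_prod a b k))%:R :> R by rewrite ler1n pdeg_fpoly_prod_gt0.
have d0 : 0 <= (pdeg g)%:R :> R by exact: ler0n.
(* It suffices to reach [eps deg g], since [deg f >= 1]. *)
apply: (@le_trans _ _ (rho * eps * (pdeg g)%:R)); first by rewrite !ler_wpM2r // ltW.
have -> : eps * ((pdeg (fpoly_prod a b k))%:R * (pdeg g)%:R) * rho =
  rho * eps * (pdeg g)%:R * (pdeg (fpoly_prod a b k))%:R by ring.
by rewrite ler_peMr // !mulr_ge0 // ltW.
Qed.
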